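(* Let $q,\beta>0$, $0<\alpha<1$, $n\in\mathbb{N}$ with $n^{1-\alpha}>2$, $x\in\mathbb{R}$, $N\in\mathbb{N}$, and $f\in C^N(\mathbb{R})$ with $f^{(N)}\in C_B(\mathbb{R})$. Put $$\rho_n:=\frac{\omega\left(f^{(N)},\frac1{n^\alpha}\right)}{n^{\alpha N}N!}+\frac{2^{N+2}\|f^{(N)}\|_\infty e^{\beta}\left(q+\frac1q\right)}{n^N\beta^N}e^{-\frac{\beta n^{1-\alpha}}{2}}.$$ Then: (i) $$\left|B_n(f)(x)-f(x)-\sum_{k=1}^N\frac{f^{(k)}(x)}{k!}B_n\left((\cdot-x)^k\right)(x)\right|\le\rho_n,$$ and $\rho_n\to0$ as $n\to\infty$. (ii) If $f^{(k)}(x)=0$ for $k=1,\dots,N$, then $|B_n(f)(x)-f(x)|\le\rho_n$. (iii) $$|B_n(f)(x)-f(x)|\le\sum_{k=1}^N\frac{|f^{(k)}(x)|}{k!}\frac1{n^k}\left[\frac{1-e^{-\beta}}{1+e^{-\beta}}\cdot\frac1{k+1}+\left(q+\frac1q\right)\frac{e^\beta k!}{\beta^k}\right]+\rho_n.$$ (iv) $$\|B_n(f)-f\|_\infty\le\sum_{k=1}^N\frac{\|f^{(k)}\|_\infty}{k!}\frac1{n^k}\left[\frac{1-e^{-\beta}}{1+e^{-\beta}}\cdot\frac1{k+1}+\left(q+\frac1q\right)\frac{e^\beta k!}{\beta^k}\right]+\rho_n.$$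
   Context: $\mathbb{N}=\{1,2,\dots\}$. For $q,\beta>0$ and $x\in\mathbb{R}$ let $\nu_{q}(x)=\frac{1-qe^{-\beta x}}{1+qe^{-\beta x}}$ and $G_{q,\beta}(x)=\frac14\left(\nu_{q}(x+1)-\nu_{q}(x-1)\right)$; $G_{1/q,\beta}$ is the same with $q$ replaced by $1/q$. Let $\Psi=\frac12\left(G_{q,\beta}+G_{1/q,\beta}\right)$ (an even probability density on $\mathbb{R}$). $C_B(\mathbb{R})$ is the set of continuous bounded real functions on $\mathbb{R}$; $C^N(\mathbb{R})$ is the set of $N$ times continuously differentiable real functions. $\|g\|_\infty=\sup_{x\in\mathbb{R}}|g(x)|\in[0,\infty]$ (the bound (iv) is vacuous if some $\|f^{(k)}\|_\infty$ is infinite). For $\theta>0$, $\omega(g,\theta)=\sup\{|g(x)-g(y)|: x,y\in\mathbb{R},\ |x-y|\le\theta\}$. The operator $B_n$ is $$B_n(f)(x)=\int_{-\infty}^{\infty}f\left(\frac vn\right)\Psi(nx-v)\,dv ,$$ applied also to unbounded functions for which the integral converges absolutely; in particular $B_n\left((\cdot-x)^k\right)(x)=\int_{-\infty}^\infty\left(\frac vn-x\right)^k\Psi(nx-v)\,dv$. *)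

(* Defs.v *)
From HB Require Import structures.
From mathcomp Require Import all_boot all_order all_algebra.
From mathcomp Require Import all_classical all_reals all_analysis.

Set Implicit Arguments.
Unset Strict Implicit.
Unset Printing Implicit Defensive.

Import Order.TTheory GRing.Theory Num.Theory.
Import numFieldNormedType.Exports.

Local Open Scope ring_scope.
Local Open Scope classical_set_scope.

Definition nu (R : realType) (q beta x : R) : R :=
  (1 - q * expR (- (beta * x))) / (1 + q * expR (- (beta * x))).

Definition G (R : realType) (q beta x : R) : R :=
  4^-1 * (nu q beta (x + 1) - nu q beta (x - 1)).

Definition Psi (R : realType) (q beta x : R) : R :=
  2^-1 * (G q beta x + G q^-1 beta x).

(* The value is kept in \bar R instead of being truncated to R: the integral of
   a measurable function is finite exactly when it converges absolutely
   (+oo - +oo is -oo), so any finite bound involving B q beta n f x also asserts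
   that it is well defined. *)
Definition B (R : realType) (q beta : R) (n : nat) (f : R -> R) (x : R)
    : \bar R :=
  (\int[lebesgue_measure]_v (f (v / n%:R) * Psi q beta (n%:R * x - v))%:E)%E.

(* derive1n is total, hence the explicit derivability of the lower
   derivatives; it also gives their continuity. *)
Definition C_n (R : realType) (N : nat) (f : R -> R) : Prop :=
  (forall k, (k < N)%N -> forall x, derivable f^`(k) x 1) /\
  continuous f^`(N).

Definition C_B (R : realType) (g : R -> R) : Prop :=
  continuous g /\ bounded_fun g.

Definition supnorm (R : realType) (g : R -> R) : \bar R :=
  ereal_sup [set (`|g x|)%:E | x in [set: R]].

Definition modulus (R : realType) (g : R -> R) (theta : R) : \bar R :=
  ereal_sup [set (`|g p.1 - g p.2|)%:E | p in [set p : R * R | `|p.1 - p.2| <= theta]].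

Definition rho (R : realType) (q beta alpha : R) (N : nat) (f : R -> R)
    (n : nat) : \bar R :=
  (modulus f^`(N) (n%:R `^ alpha)^-1
     * ((n%:R `^ (alpha * N%:R) * N`!%:R)^-1)%:E
   + supnorm f^`(N)
     * (2 ^+ (N + 2) * expR beta * (q + q^-1) / (n%:R ^+ N * beta ^+ N)
        * expR (- (beta * n%:R `^ (1 - alpha) / 2)))%:E)%E.

(* Upper bound for n^k times the absolute value of B_n((. - x)^k)(x). *)
Definition moment_bound (R : realType) (q beta : R) (k : nat) : R :=
  (1 - expR (- beta)) / (1 + expR (- beta)) * (k.+1%:R)^-1
  + (q + q^-1) * (expR beta * k`!%:R / beta ^+ k).

(* Main.v *)
(* With a = q e^(-beta x) and E = e^beta one has
   G_q(x) = (a/2) (E - 1/E) / ((1 + a/E) (1 + a E)), which gives both the sharp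
   bound (E - 1)/(2 (E + 1)) and, as E - 1/E <= 2 beta E, the exponential bound
   beta q E e^(-beta x); moreover Psi is even of total mass 1.  Taylor's formula
   with Lagrange remainder splits f(v/n) into the Taylor polynomial at x, which
   produces the moments of B_n, and a remainder.  The remainder is at most
   omega(f^(N), n^-alpha) n^(-alpha N) / N! where |v/n - x| <= n^-alpha and at
   most 2 ||f^(N)|| |v/n - x|^N / N! elsewhere; there the exponential bound and
   u^N e^(-beta u) <= N! (2/beta)^N e^(-beta u/2) give the second term of rho_n.
   The moments are bounded by the sharp bound on |u| <= 1 and by the exponential
   one, with the Gamma integral, on |u| >= 1. *)

Require Import Defs.
From HB Require Import structures.
From mathcomp Require Import all_boot all_order all_algebra.
From mathcomp Require Import all_classical all_reals all_analysis.
From mathcomp Require Import measurable_realfun.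
From mathcomp Require Import ring lra.

Set Implicit Arguments.
Unset Strict Implicit.
Unset Printing Implicit Defensive.

Import Order.TTheory GRing.Theory Num.Theory.
Import numFieldNormedType.Exports.

Local Open Scope ring_scope.
Local Open Scope classical_set_scope.

(** * Elementary facts on the exponential *)

Lemma expn_fact_le_expR (R : realType) (x : R) (n : nat) :
  0 <= x -> x ^+ n <= n`!%:R * expR x.
Proof.
move=> x0; have fgt0 : (0 : R) < n`!%:R by rewrite ltr0n fact_gt0.
rewrite mulrC -ler_pdivrMr//; case: n fgt0 => [|n] _.
  by rewrite expr0 divr1; apply: le_trans (expR_ge1Dx x); rewrite lerDl.
by apply: le_trans (expR_ge1Dxn n x0); rewrite lerDr.
Qed.

Section derive_exponential.
Context {R : realType}.

Lemma is_derive_mull (c x : R) : is_derive x 1 (fun y => c * y) c.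
Proof.
refine (is_derive_eq (is_deriveZ c (is_derive_id x 1)) _).
by rewrite [LHS]mulr1.
Qed.

Lemma is_derive_expRM (c x : R) :
  is_derive x 1 (fun y => expR (c * y)) (c * expR (c * x)).
Proof.
refine (is_derive_eq (is_derive1_comp (is_derive_expR (c * x)) (is_derive_mull c x)) _).
by rewrite mulrC.
Qed.

End derive_exponential.

(** * Symmetry and pointwise bounds of the density *)

Section density.
Context {R : realType}.
Implicit Types q beta x : R.

(** Reflection turns q into 1/q, so averaging [G] over q and 1/q yields an even function. *)
Lemma nu_opp q beta x : 0 < q -> nu q beta (- x) = - nu q^-1 beta x.
Proof.
move=> q0; rewrite /nu mulrN opprK expRN.
have := expR_gt0 (beta * x); move: (expR _) => e e0.
by field; rewrite !gt_eqF// ?addr_gt0 ?mulr_gt0.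
Qed.

Lemma G_opp q beta x : 0 < q -> G q beta (- x) = G q^-1 beta x.
Proof.
move=> q0; rewrite /G.
have -> : - x + 1 = - (x - 1) by ring.
have -> : - x - 1 = - (x + 1) by ring.
by rewrite !nu_opp//; ring.
Qed.

Lemma Psi_even q beta x : 0 < q -> Psi q beta (- x) = Psi q beta x.
Proof.
by move=> q0; rewrite /Psi !G_opp ?invr_gt0// invrK addrC.
Qed.

(** Here x enters only through [a], so positivity and both upper bounds become rational inequalities
    in [a] and [E]. *)
Lemma GE q beta x (a := q * expR (- (beta * x))) (E := expR beta) : 0 < q ->
  G q beta x = 2^-1 * a * (E - E^-1) / ((1 + a / E) * (1 + a * E)).
Proof.
move=> q0; rewrite /G /nu.
have -> : - (beta * (x + 1)) = - (beta * x) - beta by ring.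
have -> : - (beta * (x - 1)) = - (beta * x) + beta by ring.
rewrite !expRD (expRN beta) -/E !(mulrA q) -/a.
have E0 : 0 < E by exact: expR_gt0.
have a0 : 0 < a by rewrite mulr_gt0 ?expR_gt0.
clearbody a E.
by field; rewrite !gt_eqF// ?addr_gt0 ?mulr_gt0.
Qed.

Lemma G_ge0 q beta x : 0 < q -> 0 <= beta -> 0 <= G q beta x.
Proof.
move=> q0 b0; rewrite GE//.
have E1 : 1 <= expR beta by rewrite -expR0 ler_expR.
have E0 : 0 < expR beta by exact: expR_gt0.
have a0 : 0 <= q * expR (- (beta * x)) by rewrite mulr_ge0 ?expR_ge0 ?ltW.
have d0 : 0 <= expR beta - (expR beta)^-1.
  by rewrite subr_ge0 (@le_trans _ _ 1)// invf_le1.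
move: a0; move: (q * _) => a a0.
apply: divr_ge0; first by rewrite !mulr_ge0.
by rewrite mulr_ge0// addr_ge0// ?divr_ge0// ?mulr_ge0// ltW.
Qed.

(* The maximum is attained where q e^(-beta x) = 1; the difference of the two
   sides is a multiple of (1 - q e^(-beta x))^2. *)
Lemma G_le_max q beta x : 0 < q -> 0 <= beta ->
  G q beta x <= 2^-1 * ((1 - expR (- beta)) / (1 + expR (- beta))).
Proof.
move=> q0 b0; rewrite GE// (expRN beta).
have E1 : 1 <= expR beta by rewrite -expR0 ler_expR.
have a0 : 0 < q * expR (- (beta * x)) by rewrite mulr_gt0 ?expR_gt0.
move: E1 a0; move: (expR beta) (q * _) => E a E1 a0.
have E0 : 0 < E by lra.
have -> : (1 - E^-1) / (1 + E^-1) = (E - 1) / (E + 1).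
  by field; rewrite !gt_eqF// addr_gt0.
rewrite -subr_ge0.
have -> : 2^-1 * ((E - 1) / (E + 1)) -
    2^-1 * a * (E - E^-1) / ((1 + a / E) * (1 + a * E)) =
    2^-1 * (E - 1) * E * (1 - a) ^+ 2 / ((E + 1) * (E + a) * (1 + a * E)).
  by field; rewrite !gt_eqF// ?addr_gt0 ?mulr_gt0.
apply: divr_ge0.
  by rewrite mulr_ge0 ?sqr_ge0// mulr_ge0 ?mulr_ge0 ?subr_ge0// ltW.
by rewrite !mulr_ge0 ?addr_ge0 ?mulr_ge0// ltW.
Qed.

Lemma G_le_exp q beta x : 0 < q -> 0 <= beta ->
  G q beta x <= beta * q * expR beta * expR (- (beta * x)).
Proof.
move=> q0 b0; rewrite GE//.
(* After division by E = e^beta this is e^(-2 beta) >= 1 - 2 beta, the tangent bound for the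
   exponential at 0. *)
have h : expR beta - (expR beta)^-1 <= 2 * beta * expR beta.
  have := expR_ge1Dx (- beta * 2%:R); rewrite expRM_natr expRN.
  have := expR_gt0 beta; move: (expR beta) => E E0 h.
  rewrite -subr_ge0.
  have -> : 2 * beta * E - (E - E^-1) = E * (E^-1 ^+ 2 - (1 - beta * 2)).
    by field; rewrite gt_eqF.
  by rewrite mulr_ge0 ?(ltW E0)// subr_ge0 -mulNr.
have E1 : 1 <= expR beta by rewrite -expR0 ler_expR.
have a0 : 0 < q * expR (- (beta * x)) by rewrite mulr_gt0 ?expR_gt0.
have -> : beta * q * expR beta * expR (- (beta * x)) =
  2^-1 * (q * expR (- (beta * x))) * (2 * beta * expR beta) by field.
move: h E1 a0; move: (expR beta) (q * _) => E a h E1 a0.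
have E0 : 0 < E by lra.
have d1 : 1 <= (1 + a / E) * (1 + a * E).
  by rewrite mulr_ege1// lerDl ?divr_ge0 ?mulr_ge0// ltW.
rewrite ler_pdivrMr ?(lt_le_trans ltr01)//.
apply: (@le_trans _ _ (2^-1 * a * (2 * beta * E))).
  by rewrite ler_pM2l// mulr_gt0.
by rewrite ler_peMr// !mulr_ge0// ltW.
Qed.

Lemma Psi_ge0 q beta x : 0 < q -> 0 <= beta -> 0 <= Psi q beta x.
Proof.
by move=> q0 b0; rewrite /Psi mulr_ge0 ?addr_ge0 ?G_ge0 ?invr_gt0.
Qed.

Lemma Psi_le_max q beta x : 0 < q -> 0 <= beta ->
  Psi q beta x <= 2^-1 * ((1 - expR (- beta)) / (1 + expR (- beta))).
Proof.
move=> q0 b0; rewrite /Psi.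
have := G_le_max x q0 b0.
have := @G_le_max q^-1 beta x; rewrite invr_gt0 => /(_ q0 b0); lra.
Qed.

(** Averaging the bounds for q and 1/q produces q + 1/q. The bound decays only to the right;
    evenness lets it be applied at |x| later. *)
Lemma Psi_le_exp q beta x : 0 < q -> 0 <= beta ->
  Psi q beta x <= 2^-1 * (beta * (q + q^-1) * expR beta) * expR (- (beta * x)).
Proof.
move=> q0 b0; rewrite /Psi.
have := G_le_exp x q0 b0.
have := @G_le_exp q^-1 beta x; rewrite invr_gt0 => /(_ q0 b0); lra.
Qed.

Lemma continuous_nu q beta : 0 < q -> continuous (nu q beta).
Proof.
move=> q0 x.
have ce : q * expR (- (beta * y)) @[y --> x] --> q * expR (- (beta * x)).
  apply: cvgM; first exact: cvg_cst.
  apply: continuous_cvg; first exact: continuous_expR.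
  by apply: cvgN; apply: cvgM => //; exact: cvg_cst.
apply: cvgM; first by apply: cvgB => //; exact: cvg_cst.
apply: cvgV; first by rewrite gt_eqF// addr_gt0// mulr_gt0 ?expR_gt0.
by apply: cvgD => //; exact: cvg_cst.
Qed.

Lemma continuous_Psi q beta : 0 < q -> continuous (Psi q beta).
Proof.
move=> q0; have cG r : 0 < r -> continuous (G r beta).
  move=> r0 x; apply: cvgM; first exact: cvg_cst.
  by apply: cvgB; apply: continuous_cvg; try exact: continuous_nu;
    apply: cvgD => //; exact: cvg_cst.
move=> x; apply: cvgM; first exact: cvg_cst.
by apply: cvgD; apply: cG; rewrite ?invr_gt0.
Qed.

(** * Explicit primitives of [nu] and [Psi] *)

(** With a = q e^(-beta x), [nu] is 1 - 2 a / (1 + a), and a / (1 + a) is the derivative of ln (1 +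
    a) divided by -beta. *)
Definition nu_primitive q beta x : R :=
  x + 2 / beta * ln (1 + q * expR (- beta * x)).

Lemma is_derive_nu_primitive q beta x : 0 < q -> 0 < beta ->
  is_derive x 1 (nu_primitive q beta) (nu q beta x).
Proof.
move=> q0 b0; set e := fun y => 1 + q * expR (- beta * y).
have e0 : 0 < e x by rewrite addr_gt0// mulr_gt0 ?expR_gt0.
have de : is_derive x 1 e (q * (- beta * expR (- beta * x))).
  refine (is_derive_eq (is_deriveD (is_derive_cst (1 : R) x 1)
      (is_deriveZ q (is_derive_expRM (- beta) x))) _).
  by rewrite add0r.
refine (is_derive_eq (is_deriveD (is_derive_id (x : R) 1) (is_deriveZ (2 / beta)
  (is_derive1_comp (is_derive1_ln e0) de))) _).
rewrite /nu -(mulNr beta) [_ *: _]mulrC /e.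
have := expR_gt0 (- beta * x); move: (expR _) => E E0.
by field; rewrite !gt_eqF// ?addr_gt0// mulr_gt0.
Qed.

(** Integrated form of the reflection rule for [nu]. The constant (2 / beta) ln q cancels in
    differences, which makes the primitive of [Psi] vanish at 0. *)
Lemma nu_primitiveV q beta x : 0 < q -> 0 < beta ->
  nu_primitive q^-1 beta x = nu_primitive q beta (- x) - 2 / beta * ln q.
Proof.
move=> q0 b0; rewrite /nu_primitive.
have -> : 1 + q^-1 * expR (- beta * x) =
    (1 + q * expR (- beta * - x)) / q * expR (- beta * x).
  rewrite mulrN expRN; have := expR_gt0 (- beta * x).
  by move: (expR _) => E E0; field; rewrite !gt_eqF.
rewrite lnM ?ln_div ?expRK ?posrE ?divr_gt0 ?expR_gt0 ?addr_gt0 ?mulr_gt0 ?expR_gt0//.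
by field; rewrite gt_eqF.
Qed.

Definition Psi_primitive q beta x : R :=
  8^-1 * (nu_primitive q beta (x + 1) - nu_primitive q beta (x - 1)
    + (nu_primitive q^-1 beta (x + 1) - nu_primitive q^-1 beta (x - 1))).

Lemma Psi_primitive0 q beta : 0 < q -> 0 < beta -> Psi_primitive q beta 0 = 0.
Proof.
by move=> q0 b0; rewrite /Psi_primitive !add0r !nu_primitiveV// opprK; ring.
Qed.

Lemma is_derive_Psi_primitive q beta x : 0 < q -> 0 < beta ->
  is_derive x 1 (Psi_primitive q beta) (Psi q beta x).
Proof.
move=> q0 b0.
have d r (c : R) : 0 < r ->
    is_derive x 1 (fun y => nu_primitive r beta (y + c)) (nu r beta (x + c)).
  move=> r0; refine (is_derive_eq (@is_derive1_comp _ _ (shift c) x _ _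
      (is_derive_nu_primitive (x + c) r0 b0) (is_derive_shift x 1 c)) _).
  by rewrite mulr1.
have qV0 : 0 < q^-1 by rewrite invr_gt0.
refine (is_derive_eq (is_deriveZ 8^-1 (is_deriveD
    (is_deriveB (d q 1 q0) (d q (- 1) q0))
    (is_deriveB (d q^-1 1 qV0) (d q^-1 (- 1) qV0)))) _).
by rewrite /Psi /G [LHS]mulrC; field.
Qed.

Lemma cvg_expRN_pinfty beta (c : R) : 0 < beta ->
  expR (- beta * (x + c)) @[x --> +oo] --> (0 : R).
Proof.
move=> b0.
under eq_cvg do rewrite mulNr.
apply: (cvg_comp (fun x => beta * (x + c)) (fun x => expR (- x)) _
  (@cvgr_expR R)).
by apply: gt0_cvgMry => //; exact: cvg_addrr.
Qed.

(** The logarithms tend to ln 1 = 0, and the linear parts contribute (2 + 2) / 8. The limit 1/2 is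
    the mass of [Psi] on the right half line. *)
Lemma cvg_Psi_primitive q beta : 0 < q -> 0 < beta ->
  Psi_primitive q beta x @[x --> +oo] --> (2^-1 : R).
Proof.
move=> q0 b0.
have cl r (c : R) : 0 < r ->
    ln (1 + r * expR (- beta * (x + c))) @[x --> +oo] --> (0 : R).
  move=> r0; rewrite -[X in _ --> X](@ln1 R).
  apply: continuous_cvg; first by apply: continuous_ln; rewrite ltr01.
  rewrite -[X in _ --> X]addr0; apply: cvgD; first exact: cvg_cst.
  rewrite -(mulr0 r); apply: cvgM; first exact: cvg_cst.
  exact: cvg_expRN_pinfty.
have -> : Psi_primitive q beta = fun x => 2^-1 + 8^-1 * (2 / beta *
    (ln (1 + q * expR (- beta * (x + 1))) - ln (1 + q * expR (- beta * (x - 1)))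
    + (ln (1 + q^-1 * expR (- beta * (x + 1)))
      - ln (1 + q^-1 * expR (- beta * (x - 1)))))).
  by apply/funext => x; rewrite /Psi_primitive /nu_primitive; field; rewrite gt_eqF.
rewrite -[X in _ --> X]addr0; apply: cvgD; first exact: cvg_cst.
rewrite -(mulr0 8^-1); apply: cvgM; first exact: cvg_cst.
rewrite -(mulr0 (2 / beta)); apply: cvgM; first exact: cvg_cst.
rewrite -(addr0 0) -{1}(subr0 0) -{3}(subr0 0).
by apply: cvgD; apply: cvgB; apply: cl; rewrite ?invr_gt0.
Qed.

End density.

(** * Taylor's formula with Lagrange remainder, on either side of the base point *)

Section taylor_lagrange.
Context {R : realType}.
Implicit Types x y : R.

(** Distances to x replace the order of x and y, covering both cases at once. Since c differs from
    x, the argument can be repeated between x and c. *)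
Lemma Rolle_neq (f df : R -> R) x y : x != y ->
  (forall t : R, is_derive t 1 f (df t)) -> f x = f y ->
  exists c, [/\ x != c, `|c - x| <= `|y - x| & df c = 0].
Proof.
move=> xy fdf fxy.
have df1 t : derivable f t 1 by have [] := fdf t.
have cf : continuous f.
  by move=> t; exact/differentiable_continuous/derivable1_diffP.
have df0 (c : R) : is_derive c 1 f 0 -> df c = 0.
  by move=> fc; rewrite -(@derive_val _ _ _ _ _ _ _ (fdf c)) derive_val.
case: ltgtP xy => // xy _.
  have [//| |//|c /itvP cxy /df0 dfc] := @Rolle _ f x y xy.
    exact: continuous_subspaceT.
  exists c; split=> //; first by rewrite lt_eqF// cxy.
  by rewrite !ger0_norm ?subr_ge0 ?lerD2r ?cxy// ltW.
have [//| |//|c /itvP cxy /df0 dfc] := @Rolle _ f y x xy.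
  exact: continuous_subspaceT.
exists c; split=> //; first by rewrite gt_eqF// cxy.
by rewrite !ler0_norm ?subr_le0 ?lerN2 ?lerD2r ?cxy// ltW.
Qed.

(** [F k] stands for the k-th derivative. Each use of Rolle trades the zero y of [F 0] for a zero of
    [F 1] no farther from x, and the induction continues with the shifted family. *)
Lemma iterated_Rolle (F : nat -> R -> R) N x y : x != y ->
  (forall k (t : R), (k < N)%N -> is_derive t 1 (F k) (F k.+1 t)) ->
  (forall k, (k < N)%N -> F k x = 0) -> F 0%N y = 0 ->
  exists2 z, `|z - x| <= `|y - x| & F N z = 0.
Proof.
elim: N F y => [|N IHN] F y xy dF Fx Fy; first by exists y.
have [|c [xc cy Fc]] := Rolle_neq xy (fun t => dF 0%N t isT).
  by rewrite Fy Fx.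
have [k t kN|k kN|z zc Fz] := IHN (fun k => F k.+1) c xc _ _ Fc.
- exact: dF.
- exact: Fx.
- by exists z => //; exact: le_trans cy.
Qed.

(** Repeated Rolle is applied to f(t) - p(t - x), where p has the Taylor coefficients below degree N
    and a top coefficient that makes the difference vanish at y. *)
Lemma taylor_lagrange (f : R -> R) N x y :
  (forall k, (k < N)%N -> forall t, derivable f^`(k) t 1) ->
  exists2 z, `|z - x| <= `|y - x| &
    f y = \sum_(k < N) (f^`(k))%classic x / k`!%:R * (y - x) ^+ k
          + (f^`(N))%classic z / N`!%:R * (y - x) ^+ N.
Proof.
move=> df; have [<-|xy] := eqVneq x y.
  (* As 0^0 = 1, the value f x sits in the remainder when N = 0 and in the term k = 0 otherwise. *)
  exists x => //; rewrite subrr; case: N {df} => [|N].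
    by rewrite big_ord0 add0r expr0 divr1 mulr1.
  rewrite big_ord_recl expr0 divr1 mulr1 expr0n/= mulr0 addr0 big1 ?addr0//.
  by move=> i _; rewrite expr0n mulr0.
set T := \sum_(k < N) _.
pose a k := if (k < N)%N then (f^`(k))%classic x / k`!%:R else (f y - T) / (y - x) ^+ N.
pose p := \poly_(k < N.+1) a k.
have fact_neq0 k : k`!%:R != 0 :> R by rewrite pnatr_eq0 -lt0n fact_gt0.
have yx0 : (y - x) ^+ N != 0 by rewrite expf_neq0// subr_eq0 eq_sym.
have pk k : p^`(k)`_0 = (if (k <= N)%N then a k else 0) *+ k`!.
  by rewrite coef_derivn addn0 ffactnn coef_poly.
pose F k t := (f^`(k))%classic t - p^`(k)%R.[t - x].
have [k t kN|k kN||z zy Fz] := @iterated_Rolle F N x y xy.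
- refine (is_derive_eq (is_deriveB (derivableP (df k kN t))
    (@is_derive1_comp _ _ (shift (- x)) t _ _
      (is_derive_poly p^`(k)%R (t - x)) (is_derive_shift t 1 (- x)))) _).
  by rewrite mulr1 /F derivnS derive1nS derive1E.
- rewrite /F subrr horner_coef0 pk ltnW// /a kN -mulr_natr divfK//.
  by rewrite subrr.
- rewrite /F horner_poly big_ord_recr/= {2}/a ltnn divfK//.
  rewrite (eq_bigr (fun k : 'I_N => (f^`(k))%classic x / k`!%:R * (y - x) ^+ k)).
    by rewrite -/T; ring.
  by move=> i _; rewrite /a ltn_ord.
exists z => //; move/eqP: Fz; rewrite /F subr_eq0 => /eqP ->.
(* The polynomial has degree at most N, so its N-th derivative is the constant N! [a N]; equating it
   with f^(N)(z) determines the top coefficient. *)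
rewrite (_ : (p^`(N)).[z - x] = (p^`(N))`_0); last first.
  rewrite -horner_coef0 (@size1_polyC _ p^`(N)) ?hornerC//.
  apply/leq_sizeP => j j0; rewrite coef_derivn coef_poly ifF ?mul0rn//.
  by apply/negbTE; rewrite -leqNgt -addn1 leq_add2l.
rewrite pk leqnn /a ltnn -[_ *+ N`!]mulr_natr; field.
by rewrite fact_neq0 -subr_eq0 in yx0 *.
Qed.

End taylor_lagrange.

(** * Integrals over the line and over half lines *)

Section line_integrals.
Context {R : realType}.
Notation mu := (@lebesgue_measure R).
Implicit Types (f g h F : R -> R) (a b c T : R).

Lemma continuous_measurable_EFin g (D : set R) : measurable D ->
  continuous g -> measurable_fun D (EFin \o g).
Proof.
move=> mD cg; apply/measurable_EFinP/measurable_funTS.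
exact: continuous_measurable_fun.
Qed.

Lemma ge0_is_derive_FTC2y f F a (l : R) :
  (forall x, a <= x -> 0 <= f x) -> continuous f ->
  (forall x : R, is_derive x 1 F (f x)) -> F x @[x --> +oo] --> l ->
  (\int[mu]_(x in `[a, +oo[) (f x)%:E = (l - F a)%:E)%E.
Proof.
move=> f0 cf dF Fl.
have dF1 x : derivable F x 1 by have [] := dF x.
rewrite (ge0_continuous_FTC2y f0 _ Fl)//.
- exact: continuous_subspaceT.
- apply: cvg_at_right_filter.
  exact/differentiable_continuous/derivable1_diffP.
- by move=> x _; rewrite derive1E derive_val.
Qed.

Lemma ge0_integral_translate g c : continuous g -> (forall x, 0 <= g x) ->
  (\int[mu]_x (g x)%:E = \int[mu]_x (g (x + c))%:E)%E.
Proof.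
move=> cg g0.
have dE : (shift c : R -> R)^`() = cst 1.
  by apply/funext => x; rewrite derive1E (@derive_val _ _ _ _ _ _ _ (is_derive_shift x 1 c)).
rewrite (@increasing_ge0_integration_by_substitutionT R (shift c) g)//.
- by apply: eq_integral => x _; rewrite dE /= [(_ * _) x]mulr1.
- by move=> x y xy; rewrite ltrD2r.
- by rewrite dE => x; exact: cvg_cst.
- by rewrite dE; exact: is_cvg_cst.
- by rewrite dE; exact: is_cvg_cst.
- exact: cvg_addrr_Ny.
- exact: cvg_addrr.
Qed.

Lemma ge0_integral_fold g : continuous g -> (forall x, 0 <= g x) ->
  (\int[mu]_x (g x)%:E = \int[mu]_(x in `[0%R, +oo[) (g x)%:E
     + \int[mu]_(x in `[0%R, +oo[) (g (- x))%:E)%E.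
Proof.
move=> cg g0.
have mg D : measurable D -> measurable_fun D (EFin \o g).
  by move=> mD; exact: continuous_measurable_EFin.
rewrite -(setUv `[0%R, +oo[%classic) ge0_integral_setU//=; last 4 first.
- exact: measurableC.
- by rewrite setUv; exact: mg.
- by move=> x _; rewrite lee_fin.
- exact/disj_setPCl.
congr (_ + _)%E; rewrite setCitvr integral_itv_bndo_bndc; last exact: mg.
rewrite -{1}oppr0 ge0_integration_by_substitutionNy//.
exact: continuous_subspaceT.
Qed.

(** Common estimate for the moments and the remainder: the majorants depend on |x| only, so both
    half lines satisfy the same bound, whence the factor 2. *)
Lemma ge0_integral_split_le g h1 h2 T : 0 <= T ->
  continuous g -> continuous h1 -> continuous h2 -> (forall x, 0 <= g x) ->
  (forall x, `|x| <= T -> g x <= h1 `|x|) ->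
  (forall x, T <= `|x| -> g x <= h2 `|x|) ->
  (\int[mu]_x (g x)%:E <= 2%:E * (\int[mu]_(x in `[0%R, T]) (h1 x)%:E
     + \int[mu]_(x in `[T, +oo[) (h2 x)%:E))%E.
Proof.
move=> T0 cg ch1 ch2 g0 gh1 gh2.
have half f : continuous f -> (forall x, 0 <= f x) ->
    (forall x, 0 <= x <= T -> f x <= h1 x) -> (forall x, T <= x -> f x <= h2 x) ->
    (\int[mu]_(x in `[0%R, +oo[) (f x)%:E <= \int[mu]_(x in `[0%R, T]) (h1 x)%:E
     + \int[mu]_(x in `[T, +oo[) (h2 x)%:E)%E.
  move=> cf f0 fh1 fh2.
  rewrite (@itv_bndbnd_setU _ _ _ (BRight T)) ?bnd_simp//.
  rewrite ge0_integral_setU//=; last 3 first.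
  - by apply: continuous_measurable_EFin => //; exact: measurableU.
  - by move=> x _; rewrite lee_fin.
  - rewrite disj_set2E; apply/eqP; rewrite -subset0 => x /=.
    by rewrite !in_itv/= andbT ltNge => -[/andP[_ ->]].
  apply: leeD.
    apply: ge0_le_integral => //; try exact: continuous_measurable_EFin.
    by move=> x _; rewrite lee_fin.
  rewrite integral_itv_obnd_cbnd; last exact: continuous_measurable_EFin.
  apply: ge0_le_integral => //; try exact: continuous_measurable_EFin.
  - by move=> x _; rewrite lee_fin.
  - by move=> x /=; rewrite in_itv/= andbT lee_fin => /fh2.
rewrite (ge0_integral_fold cg g0) mule_natl mule2n; apply: leeD; apply: half => //.
- by move=> x /andP[x0 xT]; rewrite -{2}(ger0_norm x0) gh1// ger0_norm.
- move=> x Tx; have x0 := le_trans T0 Tx.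
  by rewrite -{2}(ger0_norm x0) gh2// ger0_norm.
- by move=> x; apply: continuous_comp; [exact: continuousN|exact: cg].
- move=> x /andP[x0 xT].
  by rewrite -{2}(ger0_norm x0) -normrN gh1// normrN ger0_norm.
- move=> x Tx; have x0 := le_trans T0 Tx.
  by rewrite -{2}(ger0_norm x0) -normrN gh2// normrN ger0_norm.
Qed.

(** * Powers times exponentials *)

Lemma continuous_expRM c : continuous (fun x : R => expR (c * x)).
Proof.
move=> x; apply/differentiable_continuous/derivable1_diffP.
by have [] := is_derive_expRM c x.
Qed.

Lemma is_derive_expn n (x : R) :
  is_derive x 1 (fun y => y ^+ n) (n%:R * x ^+ n.-1).
Proof.
rewrite (_ : (fun y => y ^+ n) = horner 'X^n); last first.
  by apply/funext => y; rewrite hornerXn.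
refine (is_derive_eq (is_derive_poly 'X^n x) _).
by rewrite derivXn hornerMn hornerXn mulr_natl.
Qed.

Lemma cvg_expnM_expRN n b : 0 < b ->
  x ^+ n * expR (- b * x) @[x --> +oo] --> (0 : R).
Proof.
move=> b0; have b20 : 0 < b / 2 by rewrite divr_gt0.
(* Half of the exponential absorbs the power, x^n <= [C] e^(b x / 2), and the other half tends to 0.
   The [+ 0] below matches [cvg_expRN_pinfty] at c = 0. *)
pose C : R := n`!%:R / (b / 2) ^+ n.
apply: (@squeeze_cvgr _ _ _ _ (fun=> 0) (fun x => C * expR (- (b / 2) * (x + 0)))).
- near=> x; have x0 : 0 <= x by near: x; apply: nbhs_pinfty_ge; exact: num_real.
  rewrite mulr_ge0 ?exprn_ge0 ?expR_ge0//=.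
  have -> : - b * x = - (b / 2) * (x + 0) + - (b / 2) * x by field.
  rewrite expRD mulrCA mulrC ler_pM2r ?expR_gt0// mulNr expRN.
  rewrite ler_pdivrMr ?expR_gt0// /C mulrAC ler_pdivlMr ?exprn_gt0//.
  by rewrite -exprMn mulrC expn_fact_le_expR// mulr_ge0// ltW.
- exact: cvg_cst.
- rewrite -(mulr0 C); apply: cvgM; first exact: cvg_cst.
  exact: cvg_expRN_pinfty.
Unshelve. all: by end_near. Qed.

(** Integration by parts gives the recursion F_(n+1) = - x^(n+1) e^(-b x) / b + ((n+1) / b) F_n. The
    integral over the half line is then the limit 0 minus the value at 0, the Gamma integral n! /
    b^(n+1). *)
Lemma expnM_expRN_antiderivative n b : 0 < b ->
  exists F : R -> R, [/\ forall x : R, is_derive x 1 F (x ^+ n * expR (- b * x)),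
    F 0 = - (n`!%:R / b ^+ n.+1) & F x @[x --> +oo] --> (0 : R)].
Proof.
move=> b0; elim: n => [|n [F [dF F0 Fl]]].
  exists (fun x => - b^-1 * expR (- b * x)); split.
  - move=> x; refine (is_derive_eq (is_deriveZ (- b^-1) (is_derive_expRM (- b) x)) _).
    by rewrite expr0 mul1r [LHS]mulrA mulrNN mulVf ?mul1r// gt_eqF.
  - by rewrite mulr0 expR0 mulr1 expr1 mul1r.
  - rewrite -(mulr0 (- b^-1)); apply: cvgM; first exact: cvg_cst.
    have := @cvg_expRN_pinfty R b 0 b0.
    by under eq_cvg do rewrite addr0.
exists (fun x => - b^-1 * (x ^+ n.+1 * expR (- b * x)) + n.+1%:R / b * F x); split.
- move=> x; refine (is_derive_eq (is_deriveD
    (is_deriveZ (- b^-1) (is_deriveM (is_derive_expn n.+1 x)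
      (is_derive_expRM (- b) x))) (is_deriveZ (n.+1%:R / b) (dF x))) _).
  rewrite ![_ *: _]mulrC /=.
  by move: (expR _) => E; rewrite exprS; field; rewrite gt_eqF.
- rewrite F0 expr0n/= mul0r mulr0 add0r factS natrM !exprS.
  by field; rewrite expf_neq0 ?gt_eqF.
- rewrite -[X in _ --> X](addr0 0); apply: cvgD.
    rewrite -(mulr0 (- b^-1)); apply: cvgM; first exact: cvg_cst.
    exact: cvg_expnM_expRN.
  by rewrite -(mulr0 (n.+1%:R / b)); apply: cvgM => //; exact: cvg_cst.
Qed.

Lemma continuous_expnM_expRN n b : continuous (fun x : R => x ^+ n * expR (b * x)).
Proof.
move=> x; apply: cvgM; last exact: continuous_expRM.
exact: exprn_continuous.
Qed.

Lemma integral_expnM_expRN n b : 0 < b ->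
  (\int[mu]_(x in `[0%R, +oo[) (x ^+ n * expR (- b * x))%:E
    = (n`!%:R / b ^+ n.+1)%:E)%E.
Proof.
move=> b0; have [F [dF F0 Fl]] := expnM_expRN_antiderivative n b0.
rewrite (ge0_is_derive_FTC2y _ _ dF Fl) ?F0 ?sub0r ?opprK//.
- by move=> x x0; rewrite mulr_ge0 ?exprn_ge0 ?expR_ge0.
- exact: continuous_expnM_expRN.
Qed.

Lemma integral_expRN_tail b T : 0 < b ->
  (\int[mu]_(x in `[T, +oo[) (expR (- b * x))%:E = (expR (- b * T) / b)%:E)%E.
Proof.
move=> b0; pose F x := - b^-1 * expR (- b * x).
have dF (x : R) : is_derive x 1 F (expR (- b * x)).
  refine (is_derive_eq (is_deriveZ (- b^-1) (is_derive_expRM (- b) x)) _).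
  by rewrite [LHS]mulrA mulrNN mulVf ?mul1r// gt_eqF.
have Fl : F x @[x --> +oo] --> (0 : R).
  rewrite -(mulr0 (- b^-1)); apply: cvgM; first exact: cvg_cst.
  have := @cvg_expRN_pinfty R b 0 b0.
  by under eq_cvg do rewrite addr0.
rewrite (ge0_is_derive_FTC2y _ _ dF Fl).
- by rewrite /F sub0r mulNr opprK mulrC.
- by move=> x _; exact: expR_ge0.
- exact: continuous_expRM.
Qed.

Lemma integral_expn01 n :
  (\int[mu]_(x in `[0%R, 1%R]) (x ^+ n)%:E = (n.+1%:R^-1)%:E)%E.
Proof.
have dF (x : R) : is_derive x 1 (fun y => n.+1%:R^-1 * y ^+ n.+1) (x ^+ n).
  refine (is_derive_eq (is_deriveZ n.+1%:R^-1
    (is_derive_expn n.+1 x)) _).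
  by rewrite [LHS]mulrA mulVf ?mul1r// pnatr_eq0.
have cF : continuous (fun y : R => n.+1%:R^-1 * y ^+ n.+1).
  by move=> x; apply: cvgM; [exact: cvg_cst|exact: exprn_continuous].
rewrite (@continuous_FTC2 _ _ (fun y => n.+1%:R^-1 * y ^+ n.+1)) ?ltr01//.
- by rewrite expr1n expr0n/= mulr0 mulr1 sube0.
- by apply: continuous_subspaceT => x; exact: exprn_continuous.
- split; first by move=> x _; have [] := dF x.
    exact/cvg_at_right_filter/cF.
  exact/cvg_at_left_filter/cF.
- by move=> x _; rewrite derive1E; have /@derive_val := dF x.
Qed.

Lemma integral_Psi_nneg q beta : 0 < q -> 0 < beta ->
  (\int[mu]_(x in `[0%R, +oo[) (Psi q beta x)%:E = (2^-1)%:E)%E.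
Proof.
move=> q0 b0.
rewrite (ge0_is_derive_FTC2y _ _ (fun x => is_derive_Psi_primitive x q0 b0)
  (cvg_Psi_primitive q0 b0)).
- by rewrite Psi_primitive0// subr0.
- by move=> x _; rewrite Psi_ge0// ltW.
- exact: continuous_Psi.
Qed.

End line_integrals.

(** * The operator: change of variables, moments and remainders *)

Section operator_bounds.
Context {R : realType}.
Notation mu := (@lebesgue_measure R).
Implicit Types (q beta x : R) (f g r : R -> R).

Lemma Psi_norm q beta x : 0 < q -> Psi q beta `|x| = Psi q beta x.
Proof.
by move=> q0; have [x0|x0] := leP 0 x; [rewrite ger0_norm|rewrite ltr0_norm// Psi_even].
Qed.

Lemma expnM_expRN_le n beta x : 0 < beta -> 0 <= x ->
  x ^+ n * expR (- (beta * x)) <=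
  n`!%:R * (2 / beta) ^+ n * expR (- (beta / 2) * x).
Proof.
move=> b0 x0; have := @expn_fact_le_expR R (beta / 2 * x) n.
have bx0 : 0 <= beta / 2 * x by rewrite mulr_ge0// divr_ge0// ltW.
move=> /(_ bx0); rewrite exprMn => le1.
have -> : - (beta * x) = - (beta / 2) * x + - (beta / 2) * x by field.
rewrite expRD mulrA ler_pM2r ?expR_gt0// mulNr expRN ler_pdivrMr ?expR_gt0//.
rewrite mulrAC -ler_pdivrMr ?exprn_gt0 ?divr_gt0//.
by rewrite -exprVn invf_div mulrC.
Qed.

(** Substituting v = u + c turns the kernel into Psi(-u), which is Psi(u) by evenness. *)
Lemma integral_Psi_shift g q beta (c : R) : 0 < q -> 0 < beta ->
  continuous g -> (forall v, 0 <= g v) ->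
  (\int[mu]_v (g v * Psi q beta (c - v))%:E =
   \int[mu]_u (g (u + c) * Psi q beta u)%:E)%E.
Proof.
move=> q0 b0 cg g0.
rewrite (@ge0_integral_translate R (fun v => g v * Psi q beta (c - v)) c).
- by apply: eq_integral => u _; rewrite opprD addrCA subrr addr0 Psi_even.
- move=> v; apply: cvgM; first exact: cg.
  apply: continuous_cvg; first exact: continuous_Psi.
  by apply: cvgB => //; exact: cvg_cst.
- by move=> v; rewrite mulr_ge0// Psi_ge0// ltW.
Qed.

Lemma integral_Psi q beta (c : R) : 0 < q -> 0 < beta ->
  (\int[mu]_v (Psi q beta (c - v))%:E = 1)%E.
Proof.
move=> q0 b0.
transitivity (\int[mu]_v (1 * Psi q beta (c - v))%:E)%E.
  by apply: eq_integral => v _; rewrite mul1r.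
rewrite (@integral_Psi_shift (fun=> 1))//; last by move=> v; exact: cvg_cst.
under eq_integral do rewrite mul1r.
rewrite (ge0_integral_fold (continuous_Psi q0)); last first.
  by move=> u; rewrite Psi_ge0// ltW.
under [X in (_ + X)%E]eq_integral do rewrite Psi_even//.
by rewrite integral_Psi_nneg// -EFinD; congr EFin; field.
Qed.

Section kernel.
Variables (q beta : R) (n : nat) (x : R).
Hypotheses (q0 : 0 < q) (b0 : 0 < beta) (n0 : (0 < n)%N).

Let nR0 : (0 : R) < n%:R. Proof. by rewrite ltr0n. Qed.

Lemma continuous_B_integrand f : continuous f ->
  continuous (fun v : R => f (v / n%:R) * Psi q beta (n%:R * x - v)).
Proof.
move=> cf v; apply: cvgM.
  apply: continuous_cvg; first exact: cf.
  by apply: cvgM => //; exact: cvg_cst.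
apply: continuous_cvg; first exact: continuous_Psi.
by apply: cvgB => //; exact: cvg_cst.
Qed.

(** In the variable u = v - n x the distance from t = v / n to x is |u| / n, and the kernel is
    centred at 0. The absolute value supplies the nonnegativity required by the translation. *)
Lemma B_abs_shift f : continuous f ->
  (B q beta n (fun t => `|f t|)%R x =
   \int[mu]_u (`|f (u / n%:R + x)|%R * Psi q beta u)%:E)%E.
Proof.
move=> cf; rewrite /B (@integral_Psi_shift (fun v => `|f (v / n%:R)|))//.
  apply: eq_integral => u _; congr (`|f _| * _)%:E.
  by rewrite mulrDl mulrAC divff ?mul1r// gt_eqF.
move=> v; apply: continuous_cvg; first exact: norm_continuous.
apply: continuous_cvg; first exact: cf.
by apply: cvgM => //; exact: cvg_cst.
Qed.

Lemma abs_B_integrand f v :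
  (`|(f (v / n%:R) * Psi q beta (n%:R * x - v))%:E| =
   (`|f (v / n%:R)|%R * Psi q beta (n%:R * x - v))%:E)%E.
Proof. by rewrite abse_EFin normrM (ger0_norm (Psi_ge0 _ q0 (ltW b0))). Qed.

(** The triangle inequality for integrals asks only for measurability, so this is available before
    any finiteness is known. *)
Lemma le_abs_B f : continuous f ->
  (`|B q beta n f x| <= B q beta n (fun t => `|f t|)%R x)%E.
Proof.
move=> cf; have mf := continuous_measurable_EFin measurableT
  (continuous_B_integrand cf).
apply: le_trans (le_abse_integral mu measurableT mf) _.
rewrite le_eqVlt; apply/orP; left; apply/eqP/eq_integral => v _.
exact: abs_B_integrand.
Qed.

Lemma B_integrable f : continuous f ->
  (B q beta n (fun t => `|f t|)%R x < +oo)%E ->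
  mu.-integrable setT
    (fun v => (f (v / n%:R) * Psi q beta (n%:R * x - v))%:E).
Proof.
move=> cf Boo; apply/integrableP; split.
  exact: (continuous_measurable_EFin measurableT (continuous_B_integrand cf)).
by under eq_integral do rewrite abs_B_integrand.
Qed.

Lemma continuous_expn_subr k : continuous (fun t : R => (t - x) ^+ k).
Proof.
move=> t; apply: (@continuous_cvg _ _ _ _ _ _ (fun y : R => y ^+ k)).
  exact: exprn_continuous.
by apply: cvgB => //; exact: cvg_cst.
Qed.

Lemma B_abs_moment_le k :
  (B q beta n (fun t => `|(t - x) ^+ k|)%R x <=
   ((n%:R ^+ k)^-1 * moment_bound q beta k)%:E)%E.
Proof.
rewrite B_abs_shift; last exact: continuous_expn_subr.
(* [M] and [C] are the constants of the uniform and exponential bounds on [Psi]; [a] is the scale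
   n^(-k) coming from t - x = u / n. *)
pose M := 2^-1 * ((1 - expR (- beta)) / (1 + expR (- beta))).
pose C := 2^-1 * (beta * (q + q^-1) * expR beta).
pose a : R := (n%:R ^+ k)^-1.
have a0 : 0 <= a by rewrite invr_ge0 exprn_ge0.
have M0 : 0 <= M := le_trans (Psi_ge0 0 q0 (ltW b0)) (Psi_le_max 0 q0 (ltW b0)).
have C0 : 0 <= C.
  by rewrite !mulr_ge0 ?addr_ge0 ?invr_ge0 ?expR_ge0// ltW.
have aM0 : 0 <= a * M := mulr_ge0 a0 M0.
have aC0 : 0 <= a * C := mulr_ge0 a0 C0.
have normE u : `|(u / n%:R + x - x) ^+ k| = a * `|u| ^+ k.
  by rewrite addrK normrX normrM normfV exprMn exprVn (ger0_norm (ltW nR0)) mulrC.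
apply: le_trans.
  apply: (@ge0_integral_split_le R _ (fun u => a * M * u ^+ k)
    (fun u => a * C * (u ^+ k * expR (- beta * u))) 1) => //.
  - move=> u; apply: cvgM; last exact: continuous_Psi.
    under eq_cvg do rewrite normE.
    rewrite normE; apply: cvgM; first exact: cvg_cst.
    apply: (@continuous_cvg _ _ _ _ _ _ (fun y : R => y ^+ k)).
  exact: exprn_continuous.
    exact: norm_continuous.
  - by move=> u; apply: cvgM; [exact: cvg_cst|exact: exprn_continuous].
  - by move=> u; apply: cvgM; [exact: cvg_cst|exact: continuous_expnM_expRN].
  - by move=> u; rewrite mulr_ge0// Psi_ge0// ltW.
  - move=> u _; rewrite normE mulrAC ler_wpM2r ?exprn_ge0// ler_wpM2l//.
    exact/Psi_le_max/ltW.
  - move=> u _; rewrite normE mulNr.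
    rewrite [leRHS](_ : _ = a * `|u| ^+ k * (C * expR (- (beta * `|u|)))); last by ring.
    rewrite ler_wpM2l ?mulr_ge0 ?exprn_ge0// -(Psi_norm beta u q0).
    exact/Psi_le_exp/ltW.
(* The 2 for the two half lines cancels the 1/2 in [M] and [C], and the beta in [C] lowers
   beta^(k+1) to beta^k. *)
rewrite [leRHS](_ : _ = 2%:E * ((a * M)%:E * (k.+1%:R^-1)%:E
    + (a * C)%:E * (k`!%:R / beta ^+ k.+1)%:E))%E; last first.
  transitivity (2 * (a * M * k.+1%:R^-1
    + a * C * (k`!%:R / beta ^+ k.+1)))%:E => //; congr EFin.
  rewrite /moment_bound /a /M /C exprS.
  have e0 := expR_gt0 (- beta); move: (expR (- beta)) e0 => e e0.
  move: (k.+1%:R^-1) => d.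
  by field; rewrite !gt_eqF ?exprn_gt0 ?addr_gt0.
apply: lee_wpmul2l => //; apply: leeD.
  under eq_integral do rewrite EFinM.
  rewrite ge0_integralZl_EFin//.
  - by rewrite integral_expn01.
  - by move=> u /=; rewrite in_itv/= lee_fin => /andP[u0 _]; rewrite exprn_ge0.
  - apply: continuous_measurable_EFin => // u; exact: exprn_continuous.
under eq_integral do rewrite EFinM.
have cE : continuous (fun u : R => u ^+ k * expR (- beta * u)).
  exact: continuous_expnM_expRN.
rewrite ge0_integralZl_EFin//.
(* The range [1, +oo[ is enlarged to [0, +oo[, where the integral is k! / beta^(k+1). *)
- rewrite -integral_expnM_expRN// lee_wpmul2l ?lee_fin//.
  apply: ge0_subset_integral => //.
  + exact: continuous_measurable_EFin.
  + move=> u /=; rewrite in_itv/= andbT lee_fin => u0.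
    by rewrite mulr_ge0 ?exprn_ge0 ?expR_ge0.
  + by move=> u /=; rewrite !in_itv/= !andbT; apply: le_trans.
- move=> u /=; rewrite in_itv/= andbT lee_fin => u1.
  by rewrite mulr_ge0 ?exprn_ge0 ?expR_ge0// (le_trans _ u1).
- exact: continuous_measurable_EFin.
Qed.

(** Abstract form of the remainder estimate. In the variable u the cut |t - x| = delta becomes |u| =
    n delta: the inner part costs at most A since [Psi] has mass 1, the outer part is an exponential
    tail. *)
Lemma B_abs_remainder_le r (N : nat) (A K delta : R) :
  continuous r -> 0 <= A -> 0 <= K -> 0 <= delta ->
  (forall t, `|t - x| <= delta -> `|r t| <= A) ->
  (forall t, `|r t| <= K * `|t - x| ^+ N) ->
  (B q beta n (fun t => `|r t|)%R x <=
   (A + K * (2 ^+ (N + 1) * N`!%:R * expR beta * (q + q^-1)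
     / (n%:R ^+ N * beta ^+ N) * expR (- (beta * (n%:R * delta) / 2))))%:E)%E.
Proof.
move=> cr A0 K0 d0 rA rK; rewrite B_abs_shift//.
pose C := 2^-1 * (beta * (q + q^-1) * expR beta).
pose D := K * (n%:R ^+ N)^-1 * (N`!%:R * (2 / beta) ^+ N) * C.
have C0 : 0 <= C.
  by rewrite !mulr_ge0 ?addr_ge0 ?invr_ge0 ?expR_ge0// ltW.
have Kn0 : 0 <= K * (n%:R ^+ N)^-1 * C.
  by rewrite mulr_ge0// mulr_ge0 ?invr_ge0 ?exprn_ge0.
have D0 : 0 <= D.
  rewrite /D mulrAC mulr_ge0// mulr_ge0 ?exprn_ge0// divr_ge0//.
  exact: ltW.
have b20 : 0 < beta / 2 by rewrite divr_gt0.
have normE u : `|u / n%:R + x - x| = `|u| / n%:R.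
  by rewrite addrK normrM normfV (ger0_norm (ltW nR0)).
apply: le_trans.
  apply: (@ge0_integral_split_le R _ (fun u => A * Psi q beta u)
    (fun u => D * expR (- (beta / 2) * u)) (n%:R * delta)).
  - by rewrite mulr_ge0.
  - move=> u; apply: cvgM; last exact: continuous_Psi.
    apply: continuous_cvg; first exact: norm_continuous.
    apply: continuous_cvg; first exact: cr.
    apply: cvgD; last exact: cvg_cst.
    by apply: cvgM => //; exact: cvg_cst.
  - by move=> u; apply: cvgM; [exact: cvg_cst|exact: continuous_Psi].
  - by move=> u; apply: cvgM; [exact: cvg_cst|exact: continuous_expRM].
  - by move=> u; rewrite mulr_ge0// Psi_ge0// ltW.
  - move=> u u1; rewrite Psi_norm// ler_wpM2r ?Psi_ge0 ?(ltW b0)//.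
    by apply: rA; rewrite normE ler_pdivrMr// mulrC.
  - move=> u _; rewrite -(Psi_norm beta u q0).
    have := rK (u / n%:R + x); rewrite normE => rKu.
    have PC := Psi_le_exp `|u| q0 (ltW b0).
    apply: le_trans (ler_pM _ _ rKu PC) _ => //.
      by rewrite Psi_ge0// ltW.
    rewrite -/C exprMn exprVn.
    have -> : K * (`|u| ^+ N * (n%:R ^+ N)^-1) * (C * expR (- (beta * `|u|))) =
      K * (n%:R ^+ N)^-1 * C * (`|u| ^+ N * expR (- (beta * `|u|))) by ring.
    have -> : D * expR (- (beta / 2) * `|u|) = K * (n%:R ^+ N)^-1 * C *
      (N`!%:R * (2 / beta) ^+ N * expR (- (beta / 2) * `|u|)) by rewrite /D; ring.
    by rewrite ler_wpM2l ?expnM_expRN_le.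
(* The beta / 2 in [C] cancels the 2 / beta of the tail integral; the 2 for the two half lines turns
   2^N into 2^(N+1). *)
rewrite [leRHS](_ : _ = 2%:E * (A%:E * (2^-1)%:E
    + D%:E * (expR (- (beta / 2) * (n%:R * delta)) / (beta / 2))%:E))%E; last first.
  transitivity (2 * (A * 2^-1 + D * (expR (- (beta / 2) * (n%:R * delta))
    / (beta / 2))))%:E => //; congr EFin; rewrite /D /C.
  have -> : - (beta / 2) * (n%:R * delta) = - (beta * (n%:R * delta) / 2) by ring.
  move: (expR (- _)) => e; rewrite exprD expr1 exprMn exprVn.
  by field; rewrite !gt_eqF ?exprn_gt0.
apply: lee_wpmul2l => //; apply: leeD.
  under eq_integral do rewrite EFinM.
  have P0 u : (0 <= (Psi q beta u)%:E)%E by rewrite lee_fin Psi_ge0// ltW.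
  have cP : continuous (Psi q beta) := continuous_Psi q0.
  rewrite ge0_integralZl_EFin//; last exact: continuous_measurable_EFin.
  (* The inner interval is enlarged to the half line, where [Psi] has integral 1/2. *)
  rewrite -(integral_Psi_nneg q0 b0) lee_wpmul2l ?lee_fin//.
  apply: ge0_subset_integral => //.
    exact: continuous_measurable_EFin.
  by move=> u /=; rewrite !in_itv/= andbT => /andP[].
under eq_integral do rewrite EFinM.
rewrite ge0_integralZl_EFin ?integral_expRN_tail//.
by apply: continuous_measurable_EFin => //; exact: continuous_expRM.
Qed.

End kernel.
End operator_bounds.

(** * Supremum norm and modulus of continuity in [\bar R] *)

Section sup_norm.
Context {R : realType}.
Implicit Types (g : R -> R) (theta : R).

Lemma le_supnorm g x : ((`|g x|)%:E <= supnorm g)%E.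
Proof. by apply: ereal_sup_ubound; exists x. Qed.

Lemma le_modulus g theta x y : `|x - y| <= theta ->
  ((`|g x - g y|)%:E <= modulus g theta)%E.
Proof. by move=> xy; apply: ereal_sup_ubound; exists (x, y). Qed.

Lemma modulus_ge0 g theta : 0 <= theta -> (0 <= modulus g theta)%E.
Proof.
move=> t0; apply: le_trans (@le_modulus g theta 0 0 _); rewrite ?lee_fin//.
by rewrite subrr normr0.
Qed.

Lemma supnorm_ge0 g : (0 <= supnorm g)%E.
Proof. by apply: le_trans (le_supnorm g 0); rewrite lee_fin. Qed.

Lemma supnorm_fin_num g : bounded_fun g -> supnorm g \is a fin_num.
Proof.
move=> [M [_ gM]]; rewrite ge0_fin_numE ?supnorm_ge0//.
apply: (@le_lt_trans _ _ (M + 1)%:E); last exact: ltry.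
apply: ge_ereal_sup => _ [x _ <-]; rewrite lee_fin.
by apply: gM => //; rewrite ltrDl.
Qed.

Lemma modulus_le_supnorm g theta : bounded_fun g ->
  (modulus g theta <= 2%:E * supnorm g)%E.
Proof.
move=> gb; apply: ge_ereal_sup => _ [[x y] /= _ <-].
apply: (@le_trans _ _ ((`|g x|)%:E + (`|g y|)%:E)%E).
  by rewrite -EFinD lee_fin ler_normB.
by rewrite mule_natl mule2n leeD// le_supnorm.
Qed.

Lemma modulus_fin_num g theta : bounded_fun g -> 0 <= theta ->
  modulus g theta \is a fin_num.
Proof.
move=> gb t0; rewrite ge0_fin_numE ?modulus_ge0//.
apply: le_lt_trans (modulus_le_supnorm theta gb) _.
by rewrite -(fineK (supnorm_fin_num gb)) -EFinM ltry.
Qed.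

End sup_norm.

(** * The error bound tends to 0 *)

Section rho_limit.
Context {R : realType}.

Lemma cvg_natpowR (a : R) : 0 < a -> (m%:R `^ a)^-1 @[m --> \oo] --> (0 : R).
Proof.
move=> a0; apply/gtr0_cvgV0.
  near=> m; rewrite powR_gt0// ltr0n.
  by near: m; exact: nbhs_infty_gt.
apply/cvgryPge => A; near=> m.
(* The threshold for m is |A|^(1/a). *)
apply: (@le_trans _ _ (`|A| `^ a^-1 `^ a)).
  by rewrite -powRrM mulVf ?gt_eqF// powRr1// ler_norm.
apply: ge0_ler_powR; rewrite ?nnegrE ?powR_ge0 ?(ltW a0)//.
by near: m; exact: nbhs_infty_ger.
Unshelve. all: by end_near. Qed.

(** As f^(N) may fail to be uniformly continuous, its modulus is only bounded by twice the sup norm.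
    The decay comes from the powers of m, with N > 0; the exponential is bounded by 1. *)
Lemma rho_cvg0 (q beta alpha : R) (N : nat) (f : R -> R) :
  0 < q -> 0 < beta -> 0 < alpha -> (0 < N)%N -> bounded_fun f^`(N) ->
  rho q beta alpha N f m @[m --> \oo] --> 0%E.
Proof.
move=> q0 b0 a0 N0 fb.
pose S : R := fine (supnorm f^`(N)).
have SE : supnorm f^`(N) = S%:E by rewrite fineK// supnorm_fin_num.
have S0 : 0 <= S by rewrite -lee_fin -SE supnorm_ge0.
have NR0 : (0 : R) < N%:R by rewrite ltr0n.
pose C : R := 2 ^+ (N + 2) * expR beta * (q + q^-1).
have C0 : 0 <= C.
  by rewrite !mulr_ge0 ?exprn_ge0 ?expR_ge0 ?addr_ge0 ?invr_ge0// ltW.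
pose h (m : nat) : R := 2 * S * ((m%:R `^ (alpha * N%:R))^-1 * (N`!%:R)^-1)
  + S * (C * (beta ^+ N)^-1 * (m%:R `^ N%:R)^-1).
have h0 : h m @[m --> \oo] --> (0 : R).
  rewrite -(addr0 0); apply: cvgD.
    rewrite -(mulr0 (2 * S)) -(mul0r (N`!%:R)^-1).
    apply: cvgM; first exact: cvg_cst.
    apply: cvgM; last exact: cvg_cst.
    by apply: cvg_natpowR; rewrite mulr_gt0.
  rewrite -(mulr0 S); apply: cvgM; first exact: cvg_cst.
  rewrite -(mulr0 (C * (beta ^+ N)^-1)); apply: cvgM; first exact: cvg_cst.
  exact: cvg_natpowR.
apply: (@squeeze_cvge _ _ _ _ (fun=> 0%E) _ (fun m => (h m)%:E)).
- near=> m; rewrite /rho SE -/C.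
  have D0 : 0 <= (m%:R `^ (alpha * N%:R) * N`!%:R)^-1 :> R.
    by rewrite invr_ge0 mulr_ge0// powR_ge0.
  have E0 : 0 <= C / (m%:R ^+ N * beta ^+ N).
    by rewrite divr_ge0// mulr_ge0 ?exprn_ge0// ltW.
  apply/andP; split.
    rewrite adde_ge0// mule_ge0 ?lee_fin ?modulus_ge0 ?invr_ge0 ?powR_ge0//.
    by rewrite mulr_ge0 ?expR_ge0.
  rewrite /h EFinD; apply: leeD.
    rewrite -invfM EFinM EFinM -SE; apply: lee_wpmul2r; first by rewrite lee_fin.
    exact: modulus_le_supnorm.
  rewrite -EFinM lee_fin ler_wpM2l// powR_mulrn//.
  rewrite [leRHS](_ : _ = C / (m%:R ^+ N * beta ^+ N)); last first.
    by rewrite invfM; ring.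
  rewrite ler_piMr// -expR0 ler_expR oppr_le0.
  by rewrite divr_ge0// mulr_ge0 ?powR_ge0// ltW.
- exact: cvg_cst.
- by apply/fine_cvgP; split => //; near=> m.
Unshelve. all: by end_near. Qed.

End rho_limit.

(** * Taylor expansion of the operator *)

Section voronovskaya.
Context {R : realType}.
Notation mu := (@lebesgue_measure R).
Variables (q beta : R) (n : nat) (x : R).
Hypotheses (q0 : 0 < q) (b0 : 0 < beta) (n0 : (0 < n)%N).

Lemma B_moment_le k : (`|B q beta n (fun t => (t - x) ^+ k)%R x| <=
  ((n%:R ^+ k)^-1 * moment_bound q beta k)%:E)%E.
Proof.
apply: le_trans (B_abs_moment_le x q0 b0 n0 k).
exact: (le_abs_B _ _ q0 b0 (@continuous_expn_subr _ _ _)).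
Qed.

(** Finiteness is what allows the moment sums to be cancelled in [\bar R]. *)
Lemma B_moment_fin_num k : B q beta n (fun t => (t - x) ^+ k)%R x \is a fin_num.
Proof.
by rewrite -abse_fin_num ge0_fin_numE// (le_lt_trans (B_moment_le k))// ltry.
Qed.

Lemma B_moment0 : (B q beta n (fun t => (t - x) ^+ 0)%R x = 1)%E.
Proof.
rewrite -[RHS](integral_Psi (n%:R * x) q0 b0).
by apply: eq_integral => v _; rewrite expr0 mul1r.
Qed.

(** Linearity of the integral: the moments are absolutely convergent by [B_abs_moment_le], the
    remainder by hypothesis. *)
Lemma B_expansion N (f r : R -> R) (a : nat -> R) : continuous r ->
  (B q beta n (fun t => `|r t|)%R x < +oo)%E ->
  (forall t, f t = \sum_(0 <= k < N.+1) a k * (t - x) ^+ k + r t) ->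
  (B q beta n f x = \sum_(0 <= k < N.+1)
      (a k)%:E * B q beta n (fun t => (t - x) ^+ k)%R x + B q beta n r x)%E.
Proof.
move=> cr Boo fE.
have intM k : mu.-integrable setT
    (fun v => ((v / n%:R - x) ^+ k * Psi q beta (n%:R * x - v))%:E).
  apply: (B_integrable (x := x) q0 b0 (f := fun t => (t - x) ^+ k)).
    exact: continuous_expn_subr.
  exact: le_lt_trans (B_abs_moment_le x q0 b0 n0 k) (ltry _).
have intr := B_integrable q0 b0 cr Boo.
transitivity (\int[mu]_v (\sum_(0 <= k < N.+1) (a k)%:E *
    ((v / n%:R - x) ^+ k * Psi q beta (n%:R * x - v))%:E
    + (r (v / n%:R) * Psi q beta (n%:R * x - v))%:E))%E.
  apply: eq_integral => v _; rewrite fE mulrDl EFinD mulr_suml -sumEFin.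
  by congr (_ + _)%E; apply: eq_bigr => k _; rewrite -mulrA EFinM.
rewrite integralD//=; last first.
  by apply: integrable_sum => // k _; exact: integrableZl.
congr (_ + _)%E; rewrite integral_sum//; last by move=> k; exact: integrableZl.
by apply: eq_bigr => k _; rewrite integralZl.
Qed.

Lemma B_taylor_remainder_le (alpha : R) (N : nat) (f : R -> R) :
  0 < alpha -> (0 < N)%N -> C_n N f -> C_B f^`(N) ->
  (`|B q beta n f x - (f x)%:E - \sum_(1 <= k < N.+1)
      ((f^`(k))%classic x / k`!%:R)%:E * B q beta n (fun t => (t - x) ^+ k)%R x|
   <= rho q beta alpha N f n)%E.
Proof.
move=> a0 N0 [df cfN] [_ fb].
pose a k : R := (f^`(k))%classic x / k`!%:R.
pose r t := f t - \sum_(0 <= k < N.+1) a k * (t - x) ^+ k.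
have cf : continuous f.
  by move=> t; exact/differentiable_continuous/derivable1_diffP/(df 0%N N0).
have cr : continuous r.
  move=> t; apply: cvgB; first exact: cf.
  apply: cvg_big => [|k _]; first exact: add_continuous.
  apply: cvgM; first exact: cvg_cst.
  exact: continuous_expn_subr.
pose delta : R := (n%:R `^ alpha)^-1.
have nR0 : (0 : R) < n%:R by rewrite ltr0n.
have d0 : 0 <= delta by rewrite invr_ge0 powR_ge0.
pose w : R := fine (modulus f^`(N) delta).
have wE : modulus f^`(N) delta = w%:E by rewrite fineK// modulus_fin_num.
have w0 : 0 <= w by rewrite -lee_fin -wE modulus_ge0.
pose S : R := fine (supnorm f^`(N)).
have SE : supnorm f^`(N) = S%:E by rewrite fineK// supnorm_fin_num.
have S0 : 0 <= S by rewrite -lee_fin -SE supnorm_ge0.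
have factN0 : (0 : R) < N`!%:R by rewrite ltr0n fact_gt0.
(* The polynomial subtracted in [r] includes degree N, so Lagrange's form leaves a difference of two
   values of f^(N). *)
have rE t : exists2 z, `|z - x| <= `|t - x| &
    `|r t| = `|(f^`(N))%classic z - (f^`(N))%classic x| / N`!%:R * `|t - x| ^+ N.
  have [z zt fE] := taylor_lagrange x t df; exists z => //.
  rewrite /r fE big_nat_recr//= big_mkord -/(a N) /a.
  rewrite -normrX -[in RHS](gtr0_norm factN0) -normfV -!normrM.
  by congr (`|_|); ring.
have rA t : `|t - x| <= delta -> `|r t| <= w / N`!%:R * delta ^+ N.
  move=> td; have [z zt ->] := rE t.
  rewrite ler_pM ?divr_ge0 ?lerXn2r ?nnegrE// ler_pM2r ?invr_gt0//.
  by rewrite -lee_fin -wE le_modulus// (le_trans zt).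
have rK t : `|r t| <= 2 * S / N`!%:R * `|t - x| ^+ N.
  have [z zt ->] := rE t.
  rewrite ler_wpM2r ?exprn_ge0// ler_pM2r ?invr_gt0//.
  rewrite -lee_fin EFinM -SE; apply: le_trans (modulus_le_supnorm `|z - x| fb).
  exact: le_modulus.
have Br : (B q beta n (fun t => `|r t|)%R x <= rho q beta alpha N f n)%E.
  apply: le_trans.
    apply: (B_abs_remainder_le (x := x) q0 b0 n0 cr _ _ d0 rA rK).
      by rewrite mulr_ge0 ?exprn_ge0// divr_ge0// ltW.
    by rewrite divr_ge0 ?mulr_ge0// ltW.
  (* The bound is exactly [rho]: n [delta] = n^(1 - alpha), while 2 [S] / N! cancels N! and raises
     2^(N+1) to 2^(N+2). *)
  rewrite /rho -/delta wE SE -!EFinM -EFinD lee_fin.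
  rewrite le_eqVlt; apply/orP; left; apply/eqP; congr (_ + _).
    by rewrite powRrM powR_mulrn ?powR_ge0// invfM /delta exprVn; ring.
  rewrite (_ : n%:R * delta = n%:R `^ (1 - alpha)); last first.
    rewrite powRD; first by rewrite powRr1 ?ler0n// powRN.
    by rewrite (gt_eqF nR0) implybT.
  rewrite addn1 addn2 !exprS; field.
  by rewrite !gt_eqF ?exprn_gt0.
have Boo : (B q beta n (fun t => `|r t|)%R x < +oo)%E.
  apply: le_lt_trans Br _; rewrite /rho -/delta wE SE -!EFinM -EFinD; exact: ltry.
have fE t : f t = \sum_(0 <= k < N.+1) a k * (t - x) ^+ k + r t.
  by rewrite /r addrC subrK.
have := B_expansion cr Boo fE.
(* The term k = 0 is f(x) times the total mass 1. *)
rewrite big_ltn// B_moment0 mule1 {1}/a fact0 divr1.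
set T := (\sum_(1 <= k < N.+1) _)%E => ->.
have Tfin : T \is a fin_num.
  apply/sum_fin_numP => k _ _; by rewrite fin_numM// B_moment_fin_num.
apply: (le_trans _ (le_trans (le_abs_B n x q0 b0 cr) Br)).
rewrite le_eqVlt; apply/orP; left; apply/eqP; congr abse.
rewrite -[(_ + T + _)%E]addeA [(_ + (T + _))%E]addeC addeK//.
by rewrite [(T + _)%E]addeC addeK.
Qed.

(** The finite moment sum is subtracted and added back; the triangle inequality then separates it
    from the Taylor remainder. *)
Lemma B_sub_le (alpha : R) (N : nat) (f : R -> R) :
  0 < alpha -> (0 < N)%N -> C_n N f -> C_B f^`(N) ->
  (`|B q beta n f x - (f x)%:E| <= \sum_(1 <= k < N.+1)
      (`|(f^`(k))%classic x| / k`!%:R * (n%:R ^+ k)^-1 * moment_bound q beta k)%:E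
   + rho q beta alpha N f n)%E.
Proof.
move=> a0 N0 fC fB; have := B_taylor_remainder_le a0 N0 fC fB.
set T := (\sum_(1 <= k < N.+1) _)%E => BT.
have Tfin : T \is a fin_num.
  apply/sum_fin_numP => k _ _; by rewrite fin_numM// B_moment_fin_num.
rewrite -(subeK (B q beta n f x - (f x)%:E)%E Tfin) addeC.
apply: le_trans (lee_abs_add _ _) _; apply: leeD => //.
apply: le_trans (lee_abs_sum _ _ _) _; apply: lee_sum => k _.
rewrite abseM abse_EFin normrM normfV normr_nat -mulrA EFinM.
by apply: lee_wpmul2l (B_moment_le k); rewrite lee_fin divr_ge0.
Qed.

End voronovskaya.

Theorem theorem10 (R : realType) (q beta alpha : R) (n : nat) (x : R)
    (N : nat) (f : R -> R)
    (hq : 0 < q) (hbeta : 0 < beta) (halpha0 : 0 < alpha) (halpha1 : alpha < 1)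
    (hn : (0 < n)%N) (hn2 : 2 < n%:R `^ (1 - alpha)) (hN : (0 < N)%N)
    (hf : C_n N f) (hfN : C_B f^`(N)) :
  [/\ (`| B q beta n f x - (f x)%:E
          - \sum_(1 <= k < N.+1)
              ((f^`(k))%classic x / k`!%:R)%:E * B q beta n (fun t => (t - x) ^+ k)%R x |
         <= rho q beta alpha N f n)%E
      /\ rho q beta alpha N f m @[m --> \oo] --> 0%E,
      (forall k, (1 <= k <= N)%N -> f^`(k) x = 0) ->
        (`| B q beta n f x - (f x)%:E | <= rho q beta alpha N f n)%E,
      (`| B q beta n f x - (f x)%:E |
         <= \sum_(1 <= k < N.+1)
              (`|(f^`(k))%classic x| / k`!%:R * (n%:R ^+ k)^-1
                 * moment_bound q beta k)%:E
            + rho q beta alpha N f n)%E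
    & (ereal_sup [set `| B q beta n f y - (f y)%:E | | y in [set: R]]
         <= \sum_(1 <= k < N.+1)
              supnorm f^`(k)
                * ((k`!%:R)^-1 * (n%:R ^+ k)^-1 * moment_bound q beta k)%:E
            + rho q beta alpha N f n)%E].
Proof.
have fb := hfN.2.
split.
- split; first exact: B_taylor_remainder_le.
  exact: rho_cvg0.
- move=> fx0; have := B_taylor_remainder_le x hq hbeta hn halpha0 hN hf hfN.
  rewrite big_nat big1 ?sube0// => k kN.
  by rewrite fx0 ?mul0r ?mul0e//; move: kN; rewrite ltnS.
- exact: B_sub_le.
(* The pointwise estimate is used at every y; [rho] does not depend on the point. *)
- apply: ge_ereal_sup => _ [y _ <-].
  apply: le_trans (B_sub_le y hq hbeta hn halpha0 hN hf hfN) _.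
  apply: leeD => //; rewrite !big_nat; apply: lee_sum => k kN.
  rewrite -!mulrA EFinM; apply: lee_wpmul2r; last exact: le_supnorm.
  (* The factor of the sup norm is nonnegative because n^(-k) [moment_bound] dominates an absolute
     value. *)
  have := le_trans (abse_ge0 _) (B_moment_le y hq hbeta hn k).
  by rewrite !lee_fin => mb; rewrite mulr_ge0.
Qed.
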